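(* Let $\Phi:\mathcal{L}(\mathcal{H}_n)\to\mathcal{L}(\mathcal{H}_n)$ be an atomic positive map. Then $\mathcal{M}_{\{\Phi\}}$ is untypical.
   Context: $\mathcal{H}_n$ is an $n$-dimensional complex Hilbert space with a fixed orthonormal basis, $\mathcal{L}(\mathcal{H}_n)$ is the space of linear operators on it, and $t$ is the transpose map on $\mathcal{L}(\mathcal{H}_n)$ with respect to this basis. A linear map $\Phi:\mathcal{L}(\mathcal{H}_n)\to\mathcal{L}(\mathcal{H}_n)$ is positive if $\Phi(X)\ge 0$ whenever $X\ge 0$ (positive semidefinite), $k$-positive if $id_k\otimes\Phi$ is positive ($id_k$ the identity map on $\mathcal{L}(\mathcal{H}_k)$), completely positive if it is $k$-positive for all $k$, and $k$-copositive if $\Phi\circ t$ is $k$-positive. $\mathcal{P}_k$ and $\mathcal{CP}=\mathcal{P}_n$ denote the cones of $k$-positive and completely positive maps on $\mathcal{L}(\mathcal{H}_n)$. A positive map is atomic if it cannot be written as the sum of a $2$-positive map and a $2$-copositive map. With ${\rm Ad}_A(X)=AXA^*$, $\mathcal{SP}_k$ is the cone of $k$-superpositive maps: finite sums $\sum_i{\rm Ad}_{A_i}$ with ${\rm rank}(A_i)\le k$ for all $i$. For $\mathcal{Q}\subset\mathcal{P}_1$, the convex mapping cone generated by $\mathcal{Q}$ is $\mathcal{M}_{\mathcal{Q}}:=\{\sum_i\Phi_i\circ\Omega_i\circ\Psi_i:\Omega_i\in\mathcal{Q},\ \Phi_i,\Psi_i\in\mathcal{CP}\ \forall i\}$ (finite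 sums). A cone of positive maps on $\mathcal{L}(\mathcal{H}_n)$ is called typical if it can be obtained from the cones $\mathcal{P}_k$ and $\mathcal{SP}_k$ ($1\le k\le n$) by finitely many applications of the operations $\mathcal{M}\mapsto\mathcal{M}\circ t:=\{\Phi\circ t:\Phi\in\mathcal{M}\}$, $(\mathcal{M}_1,\mathcal{M}_2)\mapsto\mathcal{M}_1\cap\mathcal{M}_2$, and $(\mathcal{M}_1,\mathcal{M}_2)\mapsto\mathcal{M}_1\vee\mathcal{M}_2:=\{\Phi+\Psi:\Phi\in\mathcal{M}_1,\Psi\in\mathcal{M}_2\}$; it is untypical if it is not typical. *)

(* Defs.v *)
From HB Require Import structures.
From mathcomp Require Import all_boot all_order all_algebra.
From mathcomp Require Import boolp classical_sets reals.
From mathcomp Require Import complex mxtens.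

Set Implicit Arguments.
Unset Strict Implicit.
Unset Printing Implicit Defensive.

Import Order.TTheory GRing.Theory Num.Theory.
Local Open Scope classical_set_scope.
Local Open Scope ring_scope.
Local Open Scope sesquilinear_scope.

(* The complex numbers are R[i] for a model R of the reals.  Operators on H_n
   are identified with their matrices in the fixed orthonormal basis, and
   H_k (x) H_n with C^(k * n) through the Kronecker product "*t". *)
Notation supermap R n := 'End('M[R[i]]_n).

Section SuperMaps.
Variable R : realType.
Implicit Types (n k m : nat).
Local Notation C := R[i].

(* "0 <= z" in C means that z is real and nonnegative; over C this already
   forces X to be Hermitian. *)
Definition psd n (X : 'M[C]_n) : Prop :=
  forall v : 'cV[C]_n, 0 <= (v^t* *m X *m v) 0 0.

Definition positive_map n (F : supermap R n) : Prop :=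
  forall X : 'M[C]_n, psd X -> psd (F X).

(* F (x) G, defined on the basis of matrix units of 'M_(m * n). *)
Definition tens_map_fun m n (F : supermap R m) (G : supermap R n)
    (X : 'M[C]_(m * n)) : 'M[C]_(m * n) :=
  \sum_(i < m) \sum_(j < m) \sum_(a < n) \sum_(b < n)
    X (mxtens_index (i, a)) (mxtens_index (j, b)) *:
      (F (delta_mx i j) *t G (delta_mx a b)).

Fact tens_map_linear m n (F : supermap R m) (G : supermap R n) :
  linear (tens_map_fun F G).
Proof.
move=> c X Y; rewrite /tens_map_fun.
rewrite scaler_sumr -big_split; apply: eq_bigr => i _ /=.
rewrite scaler_sumr -big_split; apply: eq_bigr => j _ /=.
rewrite scaler_sumr -big_split; apply: eq_bigr => a _ /=.
rewrite scaler_sumr -big_split; apply: eq_bigr => b _ /=.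
by rewrite !mxE scalerDl scalerA.
Qed.

HB.instance Definition _ m n (F : supermap R m) (G : supermap R n) :=
  GRing.isLinear.Build C 'M[C]_(m * n) 'M[C]_(m * n) *:%R
    (tens_map_fun F G) (tens_map_linear F G).

Definition tens_map m n (F : supermap R m) (G : supermap R n) :
  supermap R (m * n) := linfun (tens_map_fun F G).

Lemma tens_mapE m n (F : supermap R m) (G : supermap R n) A B :
  tens_map F G (A *t B) = F A *t G B.
Proof.
rewrite lfunE /= /tens_map_fun.
have FE (p : nat) (H : supermap R p) (X : 'M[C]_p) s t :
    H X s t = \sum_i \sum_j X i j * H (delta_mx i j) s t.
  rewrite {1}(matrix_sum_delta X) linear_sum summxE.
  apply: eq_bigr => i _; rewrite linear_sum summxE.
  by apply: eq_bigr => j _; rewrite linearZ mxE.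
apply/matrixP => s t; rewrite [RHS]mxE (FE _ F) (FE _ G) summxE mulr_suml.
apply: eq_bigr => i _; rewrite summxE mulr_suml; apply: eq_bigr => j _.
rewrite summxE mulr_sumr; apply: eq_bigr => a _.
rewrite summxE mulr_sumr; apply: eq_bigr => b _.
by rewrite !mxE !mxtens_indexK /= mulrACA.
Qed.

Definition k_positive n k (F : supermap R n) : Prop :=
  positive_map (tens_map (\1%VF : supermap R k) F).

Definition completely_positive n (F : supermap R n) : Prop :=
  forall k, k_positive k F.

Definition transpose_map n : supermap R n := linfun trmx.

Definition k_copositive n k (F : supermap R n) : Prop :=
  k_positive k (F \o transpose_map n)%VF.

Definition atomic n (F : supermap R n) : Prop :=
  positive_map F /\
  ~ exists G H : supermap R n,
      [/\ k_positive 2 G, k_copositive 2 H & F = G + H].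

Definition Ad n (A : 'M[C]_n) : supermap R n :=
  linfun (mulmxr (A^t*) \o mulmx A).

Lemma AdE n (A X : 'M[C]_n) : Ad A X = A *m X *m A^t*.
Proof. by rewrite lfunE. Qed.

Definition k_superpositive n k (F : supermap R n) : Prop :=
  exists (m : nat) (A : 'I_m -> 'M[C]_n),
    (forall i, (\rank (A i) <= k)%N) /\ F = \sum_(i < m) Ad (A i).

Definition Pcone n k : set (supermap R n) := [set F | k_positive k F].
Definition SPcone n k : set (supermap R n) := [set F | k_superpositive k F].
Definition CPcone n : set (supermap R n) := [set F | completely_positive F].

Arguments Pcone : clear implicits.
Arguments SPcone : clear implicits.
Arguments CPcone : clear implicits.

Definition mapping_cone n (Q : set (supermap R n)) : set (supermap R n) :=
  [set F | exists (m : nat) (Phi Omega Psi : 'I_m -> supermap R n),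
     (forall i, [/\ Q (Omega i), CPcone n (Phi i) & CPcone n (Psi i)]) /\
     F = \sum_(i < m) (Phi i \o Omega i \o Psi i)%VF].

Inductive typical n : set (supermap R n) -> Prop :=
| typical_P k : (1 <= k <= n)%N -> typical (Pcone n k)
| typical_SP k : (1 <= k <= n)%N -> typical (SPcone n k)
| typical_transpose (M : set (supermap R n)) :
    typical M -> typical [set (F \o transpose_map n)%VF | F in M]
| typical_meet (M N : set (supermap R n)) :
    typical M -> typical N -> typical (M `&` N)
| typical_join (M N : set (supermap R n)) :
    typical M -> typical N -> typical [set F + G | F in M & G in N].

Definition untypical n (M : set (supermap R n)) : Prop := ~ typical M.

End SuperMaps.

(* Main.v *)
(* A typical cone either equals P_1 or consists of sums of a 2-positive and a
   2-copositive map: this holds for all P_k and SP_k and is preserved by the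
   three operations.  Since M_{Phi} contains the atomic map Phi, it could only
   be typical by being P_1, and then it would contain the identity.  The
   identity spans an extreme ray of P_1, and CP maps have Kraus forms, so some
   Ad_A o Phi o Ad_B would be a nonzero multiple of the identity.  This forces A
   and B to be invertible and Phi to be a multiple of Ad_(A^-1 B^-1), which is
   completely positive and hence not atomic. *)
Require Import Defs.
From mathcomp Require Import all_boot all_order all_algebra.
From mathcomp Require Import boolp classical_sets reals.
From mathcomp Require Import complex mxtens.

Set Implicit Arguments.
Unset Strict Implicit.
Unset Printing Implicit Defensive.

Import Order.TTheory GRing.Theory Num.Theory.
Local Open Scope classical_set_scope.
Local Open Scope ring_scope.
Local Open Scope sesquilinear_scope.

(** * Hermitian forms, positive semidefinite matrices and their rank-one decompositions *)

Section PositiveSemidefinite.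
Variable C : numClosedFieldType.

Lemma adjmxM m n p (A : 'M[C]_(m, n)) (B : 'M[C]_(n, p)) :
  (A *m B)^t* = B^t* *m A^t*.
Proof. by rewrite trmx_mul map_mxM. Qed.

Lemma adjmxZ m n (c : C) (A : 'M[C]_(m, n)) : (c *: A)^t* = c^* *: A^t*.
Proof. by apply/matrixP => i j; rewrite !mxE rmorphM. Qed.

Lemma adjmxD m n (A B : 'M[C]_(m, n)) : (A + B)^t* = A^t* + B^t*.
Proof. by apply/matrixP => i j; rewrite !mxE rmorphD. Qed.

Lemma adjmxN m n (A : 'M[C]_(m, n)) : (- A)^t* = - A^t*.
Proof. by apply/matrixP => i j; rewrite !mxE rmorphN. Qed.

Lemma adjmx_delta m n (i : 'I_m) (j : 'I_n) :
  (delta_mx i j)^t* = delta_mx j i :> 'M[C]_(n, m).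
Proof.
apply/matrixP => a b; rewrite !mxE andbC.
by case: (_ && _); rewrite ?rmorph1 ?rmorph0.
Qed.

Lemma form_delta n (X : 'M[C]_n) i j :
  ((delta_mx i 0 : 'cV[C]_n)^t* *m X *m (delta_mx j 0 : 'cV[C]_n)) 0 0 = X i j.
Proof. by rewrite adjmx_delta -rowE -colE !mxE. Qed.

Lemma norm_form n (u w : 'cV[C]_n) :
  (w^t* *m (u *m u^t*) *m w) 0 0 = `|(u^t* *m w) 0 0| ^+ 2.
Proof.
rewrite mulmxA -mulmxA [LHS]mxE big_ord1 normCK mulrC; congr (_ * _).
have -> : w^t* *m u = (u^t* *m w)^t* by rewrite adjmxM trmxCK.
by move: (u^t* *m w) => z; rewrite !mxE.
Qed.

Lemma cvec_norm_eq0 n (v : 'cV[C]_n) : (v^t* *m v) 0 0 = 0 -> v = 0.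
Proof.
rewrite mxE => /eqP; rewrite psumr_eq0; last first.
  by move=> i _; rewrite !mxE mulrC mul_conjC_ge0.
move=> /allP h; apply/matrixP => i j; rewrite ord1 !mxE.
have := h i (mem_index_enum i); rewrite !mxE /= mulrC mul_conjC_eq0.
by move/eqP.
Qed.

(** Polarization: the form at e_i + c e_j leaves c Y_ij + c^* Y_ji = 0, and the values c = 1 and c =
    'i together kill Y_ij. *)
Lemma form_eq0 n (Y : 'M[C]_n) :
  (forall v : 'cV[C]_n, (v^t* *m Y *m v) 0 0 = 0) -> Y = 0.
Proof.
move=> h; apply/matrixP => i j; rewrite [RHS]mxE.
have e (c : C) : c * Y i j + c^* * Y j i = 0.
  have := h (delta_mx i 0 + c *: delta_mx j 0).
  rewrite adjmxD adjmxZ !mulmxDl !mulmxDr -!scalemxAl -!scalemxAr.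
  have hd k : Y k k = 0 by rewrite -form_delta h.
  rewrite mxE [X in _ + X]mxE [X in X + _]mxE.
  by rewrite ![fun_of_matrix (_ *: _) 0 0]mxE !form_delta !hd !mulr0 addr0
    add0r.
have /eqP := e 1; rewrite rmorph1 !mul1r addrC addr_eq0 => /eqP e1.
have := e 'i; rewrite e1 conjCi mulrNN -mulrDr => /eqP.
by rewrite mulf_eq0 (negPf (neq0Ci _)) /= -mulr2n mulrn_eq0 /= => /eqP.
Qed.

(** The component w of u orthogonal to v is, by hypothesis, also orthogonal to u, hence to itself,
    so it vanishes. *)
Lemma colinear n (u v : 'cV[C]_n) :
  (forall w : 'cV[C]_n, (v^t* *m w) 0 0 = 0 -> (u^t* *m w) 0 0 = 0) ->
  exists c, u = c *: v.
Proof.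
move=> h; have [v0|v_neq0] := eqVneq ((v^t* *m v) 0 0) 0.
  exists 0; rewrite scale0r; apply: cvec_norm_eq0; apply: h.
  by rewrite (cvec_norm_eq0 v0) trmx0 map_mx0 mul0mx mxE.
set a := (v^t* *m v) 0 0 in v_neq0; set b := (v^t* *m u) 0 0.
pose w := u - (b / a) *: v.
have vw : (v^t* *m w) 0 0 = 0.
  rewrite mulmxBr -scalemxAr mxE [X in _ + X]mxE.
  by rewrite [fun_of_matrix (_ *: _) 0 0]mxE -/a -/b divfK // subrr.
have uw := h _ vw.
exists (b / a); apply/eqP; rewrite -subr_eq0 -/w; apply/eqP.
apply: cvec_norm_eq0.
rewrite {1}/w adjmxD adjmxN adjmxZ mulmxBl -scalemxAl.
by rewrite mxE uw add0r mxE [X in - X]mxE vw mulr0 oppr0.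
Qed.

(** The form takes real values, so the form of X^* - X vanishes identically and [form_eq0]
    applies. *)
Lemma psd_form_hermitian n (X : 'M[C]_n) :
  (forall v : 'cV[C]_n, 0 <= (v^t* *m X *m v) 0 0) -> X^t* = X.
Proof.
move=> hX; apply/eqP; rewrite -subr_eq0; apply/eqP; apply: form_eq0 => v.
have -> : v^t* *m (X^t* - X) *m v = (v^t* *m X *m v)^t* - v^t* *m X *m v.
  by rewrite mulmxBr mulmxBl !adjmxM trmxCK mulmxA.
move: (v^t* *m X *m v) (hX v) => z hz; rewrite !mxE.
by apply/eqP; rewrite subr_eq0; apply/eqP/CrealP/ger0_real.
Qed.

(** Spectral theorem: the eigenvalues are values of the form, hence nonnegative, and each unit
    eigenvector is scaled by the square root of its eigenvalue. *)
Lemma psd_form_sum n (X : 'M[C]_n) :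
  (forall v : 'cV[C]_n, 0 <= (v^t* *m X *m v) 0 0) ->
  exists u : 'I_n -> 'cV[C]_n, X = \sum_l u l *m (u l)^t*.
Proof.
move=> hX; have hermX := psd_form_hermitian hX.
have /orthomx_spectralP : X \is normalmx by apply/normalmxP; rewrite hermX.
have Pu := spectral_unitarymx X; rewrite invmx_unitary //.
move: (spectralmx X) (spectral_diag X) Pu => P d /unitarymxP PP eX.
have eD : diag_mx d = P *m X *m P^t*.
  by rewrite eX !mulmxA PP mul1mx -mulmxA PP mulmx1.
have d_ge0 l : 0 <= d 0 l.
  pose e : 'cV[C]_n := delta_mx l 0.
  have := hX (P^t* *m e); rewrite adjmxM trmxCK.
  have -> : e^t* *m P *m X *m (P^t* *m e) = e^t* *m diag_mx d *m e.
    by rewrite eD !mulmxA.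
  by rewrite form_delta mxE eqxx mulr1n.
exists (fun l => sqrtC (d 0 l) *: (row l P)^t*).
rewrite {1}eX; apply/matrixP => i j; rewrite summxE mul_mx_diag mxE.
apply: eq_bigr => l _; rewrite adjmxZ trmxCK -scalemxAl -scalemxAr scalerA.
rewrite -normCK ger0_norm ?sqrtC_ge0 // sqrtCK.
rewrite [RHS]mxE [fun_of_matrix (_ *m _) _ _]mxE big_ord1 !mxE.
by rewrite mulrCA mulrA.
Qed.

End PositiveSemidefinite.

(** * Extreme rays of the positive semidefinite cone, and k-positivity in terms of blocks *)

Section BlockForm.
Variable R : realType.
Local Notation C := R[i].

Lemma psd_sum n (X : 'M[C]_n) :
  psd X -> exists u : 'I_n -> 'cV[C]_n, X = \sum_l u l *m (u l)^t*.
Proof. exact: psd_form_sum. Qed.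

Lemma psd_rank1 n (u : 'cV[C]_n) : psd (u *m u^t*).
Proof. by move=> w; rewrite norm_form exprn_ge0. Qed.

(** Write X as a sum of u_l u_l^*. For w orthogonal to v the domination gives sum_l |u_l^* w|^2 <=
    0, so every u_l is a multiple of v. *)
Lemma psd_dominated n (v : 'cV[C]_n) (X : 'M[C]_n) c :
  psd X -> psd (c *: (v *m v^t*) - X) -> exists l, X = l *: (v *m v^t*).
Proof.
move=> /psd_sum[u ->] h.
have /fin_all_exists[a ua] : forall l, exists a, u l = a *: v.
  move=> l; apply: colinear => w vw.
  have := h w; rewrite mulmxBr mulmxBl -scalemxAr -scalemxAl.
  rewrite mxE [fun_of_matrix (_ *: _) 0 0]mxE norm_form vw normr0 expr0n /=.
  rewrite mulr0 add0r mxE oppr_ge0 mulmx_sumr mulmx_suml summxE => hle.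
  have : \sum_k `|((u k)^t* *m w) 0 0| ^+ 2 == 0.
    rewrite eq_le sumr_ge0 ?andbT => [|k _]; last exact: exprn_ge0.
    by under eq_bigr => k _ do rewrite -norm_form.
  rewrite psumr_eq0 => [/allP/(_ l)|k _]; last exact: exprn_ge0.
  by rewrite mem_index_enum sqrf_eq0 normr_eq0 => /(_ isT)/eqP.
exists (\sum_l a l * (a l)^*); rewrite scaler_suml; apply: eq_bigr => l _.
by rewrite ua adjmxZ -scalemxAl -scalemxAr scalerA.
Qed.

Lemma sum_mxtens (V : nmodType) m n (f : 'I_(m * n) -> V) :
  \sum_s f s = \sum_(i < m) \sum_(a < n) f (mxtens_index (i, a)).
Proof.
rewrite pair_big /= (reindex (@mxtens_index m n)) /=.
  by apply: eq_bigr => -[].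
exists (@mxtens_unindex m n) => x _;
  [exact: mxtens_indexK | exact: mxtens_unindexK].
Qed.

Definition block k n (X : 'M[C]_(k * n)) (i j : 'I_k) : 'M[C]_n :=
  \matrix_(a, b) X (mxtens_index (i, a)) (mxtens_index (j, b)).

(** Positivity on C^k (x) C^n, tested on families of k vectors so that the Kronecker indexing
    disappears. *)
Definition block_psd k n (X : 'I_k -> 'I_k -> 'M[C]_n) : Prop :=
  forall v : 'I_k -> 'cV[C]_n,
    0 <= \sum_i \sum_j ((v i)^t* *m X i j *m v j) 0 0.

Lemma formE n (X : 'M[C]_n) (u v : 'cV[C]_n) :
  (u^t* *m X *m v) 0 0 = \sum_a \sum_b (u a 0)^* * X a b * v b 0.
Proof.
rewrite mxE exchange_big /=; apply: eq_bigr => b _; rewrite mxE mulr_suml.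
by apply: eq_bigr => a _; rewrite !mxE.
Qed.

Lemma psd_block k n (X : 'M[C]_(k * n)) : psd X <-> block_psd (block X).
Proof.
have E (w : 'cV[C]_(k * n)) (v : 'I_k -> 'cV[C]_n) :
    (forall i a, w (mxtens_index (i, a)) 0 = v i a 0) ->
    (w^t* *m X *m w) 0 0 = \sum_i \sum_j ((v i)^t* *m block X i j *m v j) 0 0.
  move=> wv; rewrite formE sum_mxtens; apply: eq_bigr => i _.
  under [RHS]eq_bigr => j _ do rewrite formE.
  rewrite [RHS]exchange_big; apply: eq_bigr => a _.
  rewrite sum_mxtens; apply: eq_bigr => j _; apply: eq_bigr => b _.
  by rewrite !wv mxE.
split=> h v.
  pose w : 'cV[C]_(k * n) :=
    \col_s v (mxtens_unindex s).1 (mxtens_unindex s).2 0.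
  by rewrite -(E w) // => i a; rewrite mxE mxtens_indexK.
rewrite (E _ (fun i => \col_a v (mxtens_index (i, a)) 0)) // => i a.
by rewrite mxE.
Qed.

Lemma block_tens_map k n (F : supermap R n) (X : 'M[C]_(k * n)) i j :
  block (tens_map \1%VF F X) i j = F (block X i j).
Proof.
rewrite {1}[block X i j]matrix_sum_delta linear_sum.
apply/matrixP => a b; rewrite mxE lfunE /= /tens_map_fun.
(* Among the matrix units of the first factor only the one at (i, j) contributes to block (i, j). *)
rewrite summxE (bigD1 i) //= [X in _ + X]big1 ?addr0 => [|i' i'i]; last first.
  rewrite summxE big1 // => j' _; rewrite summxE big1 // => a' _.
  rewrite summxE big1 // => b' _.
  by rewrite mxE tensmxE id_lfunE mxE eq_sym (negPf i'i) mul0r mulr0.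
rewrite summxE (bigD1 j) //= [X in _ + X]big1 ?addr0 => [|j' j'j]; last first.
  rewrite summxE big1 // => a' _; rewrite summxE big1 // => b' _.
  rewrite mxE tensmxE id_lfunE mxE [j == _]eq_sym (negPf j'j) andbF.
  by rewrite mul0r mulr0.
rewrite !summxE; apply: eq_bigr => a' _; rewrite linear_sum !summxE.
apply: eq_bigr => b' _; rewrite linearZ mxE tensmxE id_lfunE mxE !eqxx mul1r.
by rewrite [RHS]mxE mxE.
Qed.

(** The map id_k (x) F acts on each block separately; later k-positivity arguments go through this
    form. *)
Lemma k_positiveP k n (F : supermap R n) :
  k_positive k F <->
  forall X : 'I_k -> 'I_k -> 'M[C]_n,
    block_psd X -> block_psd (fun i j => F (X i j)).
Proof.
split=> hF X.
  pose Y : 'M[C]_(k * n) := \matrix_(s, t)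
    X (mxtens_unindex s).1 (mxtens_unindex t).1
      (mxtens_unindex s).2 (mxtens_unindex t).2.
  have XE : X = block Y.
    apply/funext => i; apply/funext => j; apply/matrixP => a b.
    by rewrite !mxE !mxtens_indexK.
  rewrite XE => /psd_block/hF/psd_block hY v; have := hY v.
  by under eq_bigr do under eq_bigr do rewrite block_tens_map.
move=> /psd_block hX; apply/psd_block => v.
under eq_bigr do under eq_bigr do rewrite block_tens_map.
exact: hF.
Qed.

End BlockForm.

(** * Closure properties of k-positive maps, and the Kraus form *)

Section MapCones.
Variable R : realType.
Local Notation C := R[i].
Implicit Types (n k : nat).

Lemma k_positive1 n (F : supermap R n) : k_positive 1 F <-> positive_map F.
Proof.
have E (X : 'I_1 -> 'I_1 -> 'M[C]_n) : block_psd X <-> psd (X 0 0).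
  split=> h v; last by rewrite !big_ord1; exact: h.
  by have := h (fun=> v); rewrite !big_ord1.
rewrite k_positiveP; split=> h X; last by move=> /E/h hX; apply/E.
by move=> hX; have /E := h (fun _ _ => X) (proj2 (E _) hX).
Qed.

(** A j by j array of blocks is padded with zero blocks to size j + d; by linearity F keeps them
    zero. *)
Lemma k_positive_leq n j k (F : supermap R n) :
  (j <= k)%N -> k_positive k F -> k_positive j F.
Proof.
move=> /subnKC <-; move: (k - j)%N => d /k_positiveP hF.
apply/k_positiveP => X hX v.
pose Y (s t : 'I_(j + d)) : 'M[C]_n :=
  if (split s, split t) is (inl p, inl q) then X p q else 0.
pose w (s : 'I_(j + d)) : 'cV[C]_n := if split s is inl p then v p else 0.
have Yll p q : Y (lshift d p) (lshift d q) = X p q.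
  by rewrite /Y (unsplitK (inl p)) (unsplitK (inl q)).
have Yr s q : Y s (rshift j q) = 0.
  by rewrite /Y (unsplitK (inr q)); case: (split s).
have Yl s q : Y (rshift j q) s = 0 by rewrite /Y (unsplitK (inr q)).
(* Stated for any G: the identity gives positivity of the padded array, and F gives the
   conclusion. *)
have formY (G : supermap R n) (u : 'I_(j + d) -> 'cV[C]_n) :
    \sum_s \sum_t ((u s)^t* *m G (Y s t) *m u t) 0 0 =
    \sum_p \sum_q ((u (lshift d p))^t* *m G (X p q) *m u (lshift d q)) 0 0.
  rewrite big_split_ord /= [X in _ + X]big1 ?addr0 => [|s _]; last first.
    by rewrite big1 // => t _; rewrite Yl linear0 mulmx0 mul0mx mxE.
  apply: eq_bigr => p _; rewrite big_split_ord /=.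
  rewrite [X in _ + X]big1 ?addr0 => [|t _]; last first.
    by rewrite Yr linear0 mulmx0 mul0mx mxE.
  by apply: eq_bigr => q _; rewrite Yll.
have hY : block_psd Y.
  move=> u; have := formY \1%VF u.
  by under eq_bigr do under eq_bigr do rewrite id_lfunE; move=> ->;
    under eq_bigr do under eq_bigr do rewrite id_lfunE; exact: hX.
have := hF _ hY w; rewrite formY.
have wl p : w (lshift d p) = v p by rewrite /w (unsplitK (inl p)).
by under eq_bigr do under eq_bigr do rewrite !wl.
Qed.

Lemma k_positiveD n k (F G : supermap R n) :
  k_positive k F -> k_positive k G -> k_positive k (F + G).
Proof.
move=> /k_positiveP hF /k_positiveP hG; apply/k_positiveP => X hX v.
have E i j : ((v i)^t* *m (F + G) (X i j) *m v j) 0 0 =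
    ((v i)^t* *m F (X i j) *m v j) 0 0 + ((v i)^t* *m G (X i j) *m v j) 0 0.
  by rewrite add_lfunE mulmxDr mulmxDl mxE.
rewrite (eq_bigr _ (fun i _ => eq_bigr _ (fun j _ => E i j))).
rewrite (eq_bigr _ (fun i _ => big_split _ _ _ _ _)) big_split.
exact: addr_ge0 (hF X hX v) (hG X hX v).
Qed.

Lemma k_positive0 n k : k_positive k (0 : supermap R n).
Proof.
apply/k_positiveP => X hX v; apply: sumr_ge0 => i _; apply: sumr_ge0 => j _.
by rewrite lfunE /= mulmx0 mul0mx mxE.
Qed.

Lemma k_positive_sum n k (I : Type) (r : seq I) (P : pred I)
    (F : I -> supermap R n) :
  (forall i, P i -> k_positive k (F i)) ->
  k_positive k (\sum_(i <- r | P i) F i).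
Proof.
move=> h; apply: (big_ind (fun G : supermap R n => k_positive k G)).
- exact: k_positive0.
- exact: k_positiveD.
- exact: h.
Qed.

Lemma k_positiveZ n k c (F : supermap R n) :
  0 <= c -> k_positive k F -> k_positive k (c *: F).
Proof.
move=> c0 /k_positiveP hF; apply/k_positiveP => X hX v.
have E i j : ((v i)^t* *m (c *: F) (X i j) *m v j) 0 0 =
    c * ((v i)^t* *m F (X i j) *m v j) 0 0.
  by rewrite scale_lfunE -scalemxAr -scalemxAl mxE.
rewrite (eq_bigr _ (fun i _ => eq_bigr _ (fun j _ => E i j))).
rewrite -(eq_bigr _ (fun i _ => mulr_sumr _ _ _ _)) -mulr_sumr.
exact: mulr_ge0 c0 (hF X hX v).
Qed.

Lemma k_positive_comp n k (F G : supermap R n) :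
  k_positive k F -> k_positive k G -> k_positive k (F \o G)%VF.
Proof.
move=> /k_positiveP hF /k_positiveP hG; apply/k_positiveP => X hX.
under (_ : (fun i j => _) = (fun i j => F (G (X i j)))).
  by apply/funext => i; apply/funext => j; rewrite comp_lfunE.
exact/(hF (fun i j => G (X i j)))/hG.
Qed.

(** The form of the image at the family v_i is the original form at the family A^* v_i. *)
Lemma k_positive_Ad n k (A : 'M[C]_n) : k_positive k (Ad A).
Proof.
apply/k_positiveP => X hX v; have := hX (fun i => A^t* *m v i).
under eq_bigr do under eq_bigr do rewrite adjmxM trmxCK !mulmxA.
by under [X in _ -> 0 <= X]eq_bigr do under eq_bigr do rewrite AdE !mulmxA.
Qed.

Lemma Ad1 n : Ad 1%:M = \1%VF :> supermap R n.
Proof.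
by apply/lfunP => X; rewrite AdE id_lfunE trmx1 map_mx1 mul1mx mulmx1.
Qed.

Lemma k_positive_id n k : k_positive k (\1%VF : supermap R n).
Proof. by rewrite -Ad1; exact: k_positive_Ad. Qed.

Lemma transpose_mapK n : (transpose_map R n \o transpose_map R n)%VF = \1%VF.
Proof. by apply/lfunP => X; rewrite comp_lfunE !lfunE /= trmxK. Qed.

Lemma positive_transpose n : positive_map (transpose_map R n).
Proof.
move=> X hX v; rewrite lfunE /=; have := hX (map_mx Num.conj v).
have -> : (map_mx Num.conj v)^t* = v^T.
  by apply/matrixP => i j; rewrite !mxE conjCK.
have -> : v^t* *m X^T *m v = (v^T *m X *m map_mx Num.conj v)^T.
  by rewrite !trmx_mul trmxK map_trmx mulmxA.
by rewrite [fun_of_matrix (_^T) _ _]mxE.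
Qed.

(** Choi's argument: n-positivity makes the Choi matrix [J] positive semidefinite, and each rank-one
    term of [J], reshaped to an n by n matrix, is a Kraus operator. *)
Lemma kraus n (F : supermap R n) :
  k_positive n F ->
  exists A : 'I_(n * n) -> 'M[C]_n, F = \sum_l Ad (A l).
Proof.
move=> /k_positiveP hF.
(* This array is the unnormalized projection onto the maximally entangled vector; its form is the
   squared modulus of sum_i v_i(i). *)
have unit_psd : block_psd (fun i j : 'I_n => delta_mx i j : 'M[C]_n).
  move=> v.
  have -> : \sum_i \sum_j ((v i)^t* *m (delta_mx i j : 'M[C]_n) *m v j) 0 0 =
            (\sum_i v i i 0)^* * (\sum_j v j j 0).
    rewrite rmorph_sum mulr_suml; apply: eq_bigr => i _.
    rewrite mulr_sumr; apply: eq_bigr => j _.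
    rewrite -(mul_delta_mx (0 : 'I_1)) mulmxA -mulmxA -colE -rowE.
    by rewrite mxE big_ord1 !mxE.
  by rewrite mulrC mul_conjC_ge0.
pose J : 'M[C]_(n * n) := \matrix_(s, t)
  F (delta_mx (mxtens_unindex s).1 (mxtens_unindex t).1)
    (mxtens_unindex s).2 (mxtens_unindex t).2.
have blockJ i j : block J i j = F (delta_mx i j).
  by apply/matrixP => a b; rewrite !mxE !mxtens_indexK.
have /psd_sum[u Ju] : psd J.
  apply/psd_block => v; under eq_bigr do under eq_bigr do rewrite blockJ.
  exact: hF.
(* Column i is the i-th segment of [u l], so block (i, j) of u_l u_l^* equals A E_ij A^*. *)
exists (fun l => \matrix_(a, i) u l (mxtens_index (i, a)) 0).
apply/lfunP => X; rewrite [X]matrix_sum_delta !linear_sum.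
apply: eq_bigr => i _; rewrite !linear_sum; apply: eq_bigr => j _.
rewrite !linearZ /=; congr (_ *: _).
rewrite sum_lfunE -blockJ Ju; apply/matrixP => a b.
rewrite mxE !summxE; apply: eq_bigr => l _.
rewrite AdE -(mul_delta_mx (0 : 'I_1)) mulmxA -mulmxA -colE -rowE.
by rewrite !mxE !big_ord1 !mxE.
Qed.

End MapCones.

(** * Linear maps that are scalar on every rank-one matrix v v^* *)

Section RankOne.
Variable C : numClosedFieldType.

(** Subtracting the equations gives 2x = 2z; this separates E_ij from E_ji below. *)
Lemma add_opp_inj (V : lmodType C) (x y z t : V) :
  x + y = z + t -> - x + y = - z + t -> x = z.
Proof.
move=> e1 e2; have := congr2 (fun a b => a - b) e1 e2.
rewrite !opprD !opprK [LHS]addrACA [RHS]addrACA !subrr !addr0 -!mulr2n.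
by rewrite -!scaler_nat => /scalerI; apply; rewrite pnatr_eq0.
Qed.

(* Compares F on v v* for v = e_i + c e_j and v = e_i - c e_j with |c| = 1;
   c = 1 and c = 'i together determine F on all matrix units. *)
Lemma scalar_on_rank1 n (F : {linear 'M[C]_n -> 'M[C]_n}) :
  (forall v : 'cV[C]_n, exists l, F (v *m v^t*) = l *: (v *m v^t*)) ->
  exists l, forall X, F X = l *: X.
Proof.
(* For n = 0 all matrices are equal; otherwise index 0 exists and [l 0] is the common scalar. *)
case: n F => [|n] F h.
  by exists 0 => X; apply/matrixP => -[].
pose e i : 'cV[C]_n.+1 := delta_mx i 0.
pose E i j : 'M[C]_n.+1 := delta_mx i j.
have eE i j : e i *m (e j)^t* = E i j by rewrite adjmx_delta mul_delta_mx.
have /fin_all_exists[l Fdiag] : forall i, exists l, F (E i i) = l *: E i i.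
  by move=> i; rewrite -eE; exact: h.
(* N is made opaque so that rewriting with linearD does not unfold it. *)
have [N NE] : {N : C -> 'I_n.+1 -> 'I_n.+1 -> 'M[C]_n.+1 |
    forall c i j, N c i j = c^* *: E i j + c *: E j i} by eexists.
have sq (c : C) i j : c * c^* = 1 ->
    (e i + c *: e j) *m (e i + c *: e j)^t* = E i i + E j j + N c i j.
  move=> c1; rewrite adjmxD adjmxZ mulmxDl !mulmxDr -!scalemxAl -!scalemxAr.
  by rewrite NE scalerA c1 scale1r !eE [c *: _ + _]addrC addrACA.
have step (c : C) i j : i != j -> c * c^* = 1 ->
    l i = l j /\ F (N c i j) = l i *: N c i j.
  move=> ij c1.
  have [m] := h (e i + c *: e j); rewrite sq // => hm.
  have [m'] := h (e i + (- c) *: e j).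
  rewrite sq ?rmorphN ?mulrNN // => hm'.
  have NN : N (- c) i j = - N c i j.
    by rewrite !NE rmorphN !scaleNr opprD.
  rewrite !NN in hm'.
  move: hm hm'; rewrite !linearD linearN /= !Fdiag => hm hm'.
  (* The sum cancels F(N). Its (i, j) entry gives m = m', and its diagonal entries then give l i = m
     = l j. *)
  have := congr2 +%R hm hm'; rewrite addrACA subrr addr0 => /matrixP hs.
  have c0 : c^* != 0.
    apply/eqP => cc; move: c1; rewrite cc mulr0 => /esym/eqP.
    by rewrite oner_eq0.
  have ji : j != i by rewrite eq_sym.
  have := hs i i; have := hs j j; have := hs i j.
  rewrite NE !mxE !eqxx !(negPf ij) !(negPf ji) /=.
  rewrite !(mulr0, mulr1, addr0, add0r, oppr0) mulrN -mulrBl => /esym/eqP.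
  rewrite mulf_eq0 (negPf c0) orbF subr_eq0 => /eqP <-.
  rewrite -!mulr2n => /eqP; rewrite eqrMn2r /= => /eqP lj.
  move=> /eqP; rewrite eqrMn2r /= => /eqP li.
  split; first by rewrite li lj.
  by rewrite -NE; move: hm; rewrite li lj => /addrI.
have offdiag i j : i != j -> F (E i j) = l i *: E i j.
  move=> ij.
  have [_] := step 1 i j ij (etrans (mul1r _) (rmorph1 _)).
  have ii1 : 'i * ('i : C)^* = 1 by rewrite -normCK normCi expr1n.
  have [_] := step 'i i j ij ii1.
  rewrite !NE conjCi rmorph1 !scale1r scaleNr !linearD /=.
  rewrite linearN /= !linearZ /=.
  move=> e1 e2.
  have {}e1 : - F (E i j) + F (E j i) = l i *: (- E i j + E j i).
    apply: (scalerI (neq0Ci C)).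
    by rewrite scalerDr e1 -!scalerDr.
  by move: e2 e1; rewrite -!scalerDr !scalerDr scalerN; exact: add_opp_inj.
have lc i j : l i = l j.
  have [->//|ij] := eqVneq i j.
  by case: (step 1 i j ij (etrans (mul1r _) (rmorph1 _))).
exists (l 0) => X.
rewrite {1 2}[X]matrix_sum_delta linear_sum scaler_sumr; apply: eq_bigr => i _.
rewrite linear_sum scaler_sumr; apply: eq_bigr => j _; rewrite linearZ /=.
rewrite [RHS]scalerA mulrC -scalerA (lc 0 i); congr (_ *: _).
by have [<-|/offdiag] := eqVneq i j; first exact: Fdiag.
Qed.

End RankOne.

(** * The identity spans an extreme ray of the positive maps *)

Section Extremality.
Variable R : realType.
Local Notation C := R[i].
Implicit Types (n k : nat).

Lemma positive_sum n (I : Type) (r : seq I) (P : pred I)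
    (F : I -> supermap R n) :
  (forall i, P i -> positive_map (F i)) ->
  positive_map (\sum_(i <- r | P i) F i).
Proof.
move=> h; apply/k_positive1/k_positive_sum => i Pi.
exact/k_positive1/h.
Qed.

Lemma id_extremal n (I : finType) (F : I -> supermap R n) c :
  (forall i, positive_map (F i)) -> \sum_i F i = c *: \1%VF ->
  forall i, exists l, F i = l *: \1%VF.
Proof.
move=> hF sumF i; have [v|l Fl] := @scalar_on_rank1 _ _ (F i); last first.
  by exists l; apply/lfunP => X; rewrite Fl scale_lfunE id_lfunE.
apply: (@psd_dominated _ _ _ _ c); first exact/hF/psd_rank1.
have := @positive_sum _ _ (index_enum I) (fun j => j != i) F
  (fun j _ => hF j) _ (psd_rank1 v).
suff -> : \sum_(j | j != i) F j = c *: \1%VF - F i.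
  by rewrite add_lfunE opp_lfunE scale_lfunE id_lfunE.
by rewrite -sumF [in RHS](bigD1 i) //= addrAC subrr add0r.
Qed.

End Extremality.

(** * Decomposable maps and the dichotomy for typical cones *)

Section Typical.
Variables (R : realType) (n : nat).
Local Notation C := R[i].
Implicit Types (F G H : supermap R n) (M N : set (supermap R n)).

(** The property that [atomic] excludes. *)
Definition decomposable2 F : Prop :=
  exists G H, [/\ k_positive 2 G, k_copositive 2 H & F = G + H].

Lemma comp_map0l G : (0 \o G)%VF = 0 :> supermap R n.
Proof. by apply/lfunP => X; rewrite comp_lfunE !zero_lfunE. Qed.

Lemma comp_mapDl F G H :
  ((F + G) \o H)%VF = (F \o H)%VF + (G \o H)%VF :> supermap R n.
Proof. by apply/lfunP => X; rewrite !(comp_lfunE, add_lfunE). Qed.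

Lemma copositive0 k : k_copositive k (0 : supermap R n).
Proof. by rewrite /k_copositive comp_map0l; exact: k_positive0. Qed.

Lemma decomposable2_positive F : k_positive 2 F -> decomposable2 F.
Proof.
move=> hF; exists F, 0; rewrite addr0.
by split; [exact: hF | exact: copositive0 |].
Qed.

Lemma decomposable2D F G :
  decomposable2 F -> decomposable2 G -> decomposable2 (F + G).
Proof.
move=> [F1 [F2 [hF1 hF2 ->]]] [G1 [G2 [hG1 hG2 ->]]].
exists (F1 + G1), (F2 + G2); split; last by rewrite addrACA.
  exact: k_positiveD hF1 hG1.
by rewrite /k_copositive comp_mapDl; exact: k_positiveD hF2 hG2.
Qed.

Lemma transpose_comp_invol F :
  ((F \o transpose_map R n) \o transpose_map R n)%VF = F.
Proof.
by apply/lfunP => X; rewrite !comp_lfunE -[transpose_map R n (_ X)]comp_lfunE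
  transpose_mapK id_lfunE.
Qed.

Lemma decomposable2_transpose F :
  decomposable2 F -> decomposable2 (F \o transpose_map R n)%VF.
Proof.
move=> [G [H [hG hH ->]]].
exists (H \o transpose_map R n)%VF, (G \o transpose_map R n)%VF.
split; [exact: hH | | by rewrite comp_mapDl addrC].
by rewrite /k_copositive transpose_comp_invol.
Qed.

Lemma Pcone1_transpose F :
  @Pcone R n 1 F -> @Pcone R n 1 (F \o transpose_map R n)%VF.
Proof.
move=> hF; apply: k_positive_comp; first exact: hF.
exact/k_positive1/positive_transpose.
Qed.

Lemma k_superpositive_positive k j F : k_superpositive k F -> k_positive j F.
Proof.
by move=> [m [A [_ ->]]]; apply: k_positive_sum => i _; exact: k_positive_Ad.
Qed.

(** The two extra invariants serve the joins: if one cone is P_1, the join contains P_1 because the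
    other contains 0, and it stays within P_1 because both do. *)
Lemma typical_dichotomy M : typical M ->
  [/\ M `<=` decomposable2 \/ M = @Pcone R n 1, M `<=` @Pcone R n 1 & M 0].
Proof.
elim=> {M}.
- move=> k /andP[k_gt0 _]; split; last exact: k_positive0.
    have [k1|k_gt1] := leqP k 1.
      by right; congr Pcone; apply/eqP; rewrite eqn_leq k1.
    by left=> F /(k_positive_leq k_gt1); exact: decomposable2_positive.
  by move=> F; exact: k_positive_leq.
- move=> k _; split.
  + left=> F /k_superpositive_positive hF.
    by apply: decomposable2_positive; exact: hF.
  + by move=> F /k_superpositive_positive hF; exact: hF.
  + by exists 0%N, (fun=> 0); split; [case | rewrite big_ord0].
- move=> M _ [dM MP M0]; split.
  + case: dM => [dM | ->]; [left | right].
      by move=> _ [F /dM dF <-]; exact: decomposable2_transpose.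
    apply/seteqP; split=> [_ [F hF <-]|F hF]; first exact: Pcone1_transpose.
    (* P_1 is stable under the involution F |-> F o t, so it equals its image. *)
    exists (F \o transpose_map R n)%VF; first exact: Pcone1_transpose.
    exact: transpose_comp_invol.
  + by move=> _ [F /MP hF <-]; exact: Pcone1_transpose.
  + by exists 0 => //; rewrite comp_map0l.
- move=> M N _ [dM MP M0] _ [dN NP N0]; split=> //; last by move=> F [/MP].
  case: dM => [dM | ->]; first by left=> F [/dM].
  case: dN => [dN | ->]; first by left=> F [_ /dN].
  by right; rewrite setIid.
- move=> M N _ [dM MP M0] _ [dN NP N0].
  have sumP : [set F + G | F in M & G in N] `<=` @Pcone R n 1.
    by move=> _ [F /MP hF [G /NP hG <-]]; exact: k_positiveD hF hG.
  split; [|exact: sumP|]; last first.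
    by exists 0; [exact: M0 | exists 0; [exact: N0 | rewrite addr0]].
  case: dM => [dM | eM].
    case: dN => [dN | eN].
      by left=> _ [F /dM dF [G /dN dG <-]]; exact: decomposable2D dF dG.
    right; apply/seteqP; split; first exact: sumP.
    rewrite eN => F hF; exists 0; first exact: M0.
    by exists F; [exact: hF | rewrite add0r].
  right; apply/seteqP; split; first exact: sumP.
  rewrite eM => F hF; exists F; first exact: hF.
  by exists 0; [exact: N0 | rewrite addr0].
Qed.

(** * The generated mapping cone, and compositions Ad_A o F o Ad_B *)

Lemma mapping_cone_self F : mapping_cone [set F] F.
Proof.
exists 1%N, (fun=> \1%VF), (fun=> F), (fun=> \1%VF); split=> [_|].
  by split=> // k; exact: k_positive_id.
by rewrite big_ord1; apply/lfunP => X; rewrite !comp_lfunE !id_lfunE.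
Qed.

(** Indexing by pairs puts the composition in the form of a single finite sum, as [id_extremal]
    expects. *)
Lemma sandwich_Ad_sum F p q
    (A : 'I_p -> 'M[C]_n) (B : 'I_q -> 'M[C]_n) :
  ((\sum_i Ad (A i)) \o F \o (\sum_j Ad (B j)))%VF =
  \sum_(ij : 'I_p * 'I_q) (Ad (A ij.1) \o F \o Ad (B ij.2))%VF.
Proof.
rewrite -(pair_bigA _ (fun i j => (Ad (A i) \o F \o Ad (B j))%VF)) /=.
apply/lfunP => X; rewrite !comp_lfunE !sum_lfunE; apply: eq_bigr => i _.
rewrite sum_lfunE !linear_sum; apply: eq_bigr => j _.
by rewrite !comp_lfunE.
Qed.

Lemma positive_comp F G :
  positive_map F -> positive_map G -> positive_map (F \o G)%VF.
Proof. by move=> hF hG X hX; rewrite comp_lfunE; exact/hF/hG. Qed.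

Lemma completely_positive_positive F : completely_positive F -> positive_map F.
Proof. by move=> hF; exact/k_positive1/hF. Qed.

Lemma positive_Ad (A : 'M[C]_n) : positive_map (Ad A).
Proof. exact/k_positive1/k_positive_Ad. Qed.

Lemma sandwich_Ad_scalar F (A B : 'M[C]_n) c :
  positive_map F -> c != 0 -> (Ad A \o F \o Ad B)%VF = c *: \1%VF ->
  forall k, k_positive k F.
Proof.
move=> hF c_neq0 /lfunP e k.
have {}e X : A *m F (B *m X *m B^t*) *m A^t* = c *: X.
  by have := e X; rewrite !comp_lfunE !AdE scale_lfunE id_lfunE.
have uA : A \in unitmx.
  (* At X = 1 the relation, divided by c, exhibits a right inverse of A. *)
  have := e 1%:M; rewrite -mulmxA => /(congr1 ( *:%R c^-1)).
  by rewrite scalerA mulVf // scale1r scalemxAr => /mulmx1_unit[].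
have uBt : B^t* \in unitmx.
  (* A row v with v B^* = 0 makes B X B^* vanish for X = v^* v, so c v^* v = 0 and v = 0. *)
  rewrite unitmxE unitfE; apply/negP => /det0P[v v_neq0 vB].
  have := e (v^t* *m v).
  rewrite -!mulmxA vB !mulmx0 linear0 mul0mx mulmx0.
  move=> /esym/eqP; rewrite scaler_eq0 (negPf c_neq0) /= => /eqP /matrixP vv.
  move/negP: v_neq0; apply; apply/eqP/rowP => i; have := vv i i.
  rewrite !mxE big_ord1 !mxE mulrC => /eqP.
  by rewrite mul_conjC_eq0 => /eqP.
have uB : B \in unitmx by move: uBt; rewrite map_unitmx unitmx_tr.
have FE : F = c *: Ad (invmx A *m invmx B).
  apply/lfunP => X; rewrite scale_lfunE AdE adjmxM.
  (* With this argument B and B^* cancel inside F, and the relation can be solved for F X. *)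
  have := e (invmx B *m X *m invmx (B^t*)).
  rewrite !mulmxA mulmxV // mul1mx mulmxKV // => eX.
  have uAt : A^t* \in unitmx by rewrite map_unitmx unitmx_tr.
  rewrite -[F X](mulKmx uA) -[A *m F X](mulmxK uAt) eX.
  by rewrite -!map_invmx -!trmx_inv -!scalemxAl -scalemxAr !mulmxA.
(* An index is required to read off the sign of c; if there is none, F = 0. *)
have [i _|no] := pickP 'I_n; last first.
  suff -> : F = 0 by exact: k_positive0.
  by apply/lfunP => X; apply/matrixP => i; have := no i.
rewrite FE; apply: k_positiveZ; last exact: k_positive_Ad.
have psd1 : psd (1%:M : 'M[C]_n).
  move=> v; rewrite mulmx1 mxE; apply: sumr_ge0 => j _.
  by rewrite !mxE mulrC mul_conjC_ge0.
have /(_ (delta_mx i 0)) := positive_Ad A (hF _ (positive_Ad B psd1)).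
by rewrite !AdE e form_delta !mxE eqxx mulr1.
Qed.

End Typical.

Theorem theorem6 (R : realType) (n : nat) (Phi : 'End('M[R[i]]_n))
    (hPhi : atomic Phi) :
  untypical (mapping_cone [set Phi]).
Proof.
case: hPhi => Phi_pos not_dec /typical_dichotomy[[dec|eP] _ _].
  exact/not_dec/dec/mapping_cone_self.
have not2 : ~ k_positive 2 Phi by move=> /decomposable2_positive/not_dec.
(* As the mapping cone is P_1 here, it contains the identity. *)
have : @Pcone R n 1 \1%VF by exact: k_positive_id.
rewrite -eP => -[m [P [Om [Q [hPQ]]]]] id_sum.
have posC i : positive_map (P i \o Om i \o Q i)%VF.
  have [-> hP hQ] := hPQ i.
  have {}hP := completely_positive_positive hP.
  have {}hQ := completely_positive_positive hQ.
  exact: positive_comp (positive_comp hP Phi_pos) hQ.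
(* Extremality is applied twice: to the summands of the identity, then to the Kraus terms of each
   summand. A nonzero multiple of the identity among these terms would make [Phi] 2-positive. *)
have lam i : (P i \o Om i \o Q i)%VF = 0.
  have [c Ec] := id_extremal posC (etrans (esym id_sum) (esym (scale1r _))) i.
  have [OmE /(_ n)/kraus[A PA] /(_ n)/kraus[B QB]] := hPQ i.
  move: Ec; rewrite OmE PA QB sandwich_Ad_sum => Ec; apply: big1 => ij _.
  have pos_ij kl : positive_map (Ad (A kl.1) \o Phi \o Ad (B kl.2))%VF.
    apply: positive_comp (positive_Ad _).
    exact: positive_comp (positive_Ad _) Phi_pos.
  have [d Ed] := id_extremal pos_ij Ec ij.
  have [d0|d_neq0] := eqVneq d 0; first by rewrite Ed d0 scale0r.
  by case: not2; exact: sandwich_Ad_scalar Phi_pos d_neq0 Ed 2.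
(* The identity is now a sum of zeros, so Phi X = id (Phi X) = 0; this also covers n = 0. *)
apply: not2; suff -> : Phi = 0 by exact: k_positive0.
apply/lfunP => X; rewrite -[Phi X]id_lfunE id_sum big1 ?lfunE // => i _.
Qed.
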